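(* Let $d\ge1$, $0\le n\le N$ be integers and $\kappa\in\mathbb R^{d+1}$ with all $\kappa_i>-1$. For $x\in\mathbb Z_N^{d+1}$ and $\nu\in\mathbb N_0^d$ with $|\nu|=n$, $$\mathsf H_\nu(x;\kappa,N)=\frac{(-1)^n n!}{(-N)_n}\sum_{\alpha\in\mathbb Z_n^{d+1}}\frac{\mathsf H_\nu(\alpha;\kappa,n)}{\alpha!}\,\mathsf Q_\alpha(x;\kappa,N),$$ and, conversely, for $x\in\mathbb Z_N^{d+1}$ and $\alpha\in\mathbb Z_n^{d+1}$, $$\mathsf Q_\alpha(x;\kappa,N)=\frac{(\kappa+\mathbf 1)_\alpha(-N)_n}{(-1)^n(|\kappa|+d+1)_n}\sum_{\nu\in\mathbb N_0^d,\,|\nu|=n}\frac{\mathsf H_\nu(\alpha;\kappa,n)}{\mathsf B_\nu(\kappa,n)}\,\mathsf H_\nu(x;\kappa,N).$$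
   Context: Notation: $(a)_n=a(a+1)\cdots(a+n-1)$, $(a)_0=1$; for vectors, $|y|$ is the sum of the components, $\alpha!=\prod_i\alpha_i!$, $(y)_\alpha=\prod_i(y_i)_{\alpha_i}$; $\mathbf 1=(1,\dots,1)$. $\mathbb Z_N^{d+1}=\{\alpha\in\mathbb N_0^{d+1}:|\alpha|=N\}$. Inner product: $\langle f,g\rangle_{\mathsf H_{\kappa,N}}=\frac{N!}{(|\kappa|+d+1)_N}\sum_{x\in\mathbb Z_N^{d+1}}f(x)g(x)\frac{(\kappa+\mathbf 1)_x}{x!}$. $\Pi_n^d$ is the space of polynomials of total degree at most $n$ in $x_1,\dots,x_d$ ($\Pi_{-1}^d=\{0\}$), regarded as functions on $\mathbb Z_N^{d+1}$ (where $x_{d+1}=N-x_1-\cdots-x_d$); polynomials in $x_1,\dots,x_{d+1}$ are regarded as functions on $\mathbb Z_N^{d+1}$ in the same way. For $0\le n\le N$, $\mathcal V_n^d(\mathsf H_{\kappa,N})$ is the space of $p\in\Pi_n^d$ orthogonal to $\Pi_{n-1}^d$. Let $\mathrm m_\alpha(x)=(-1)^{|\alpha|}(-x)_\alpha$. For $|\alpha|\le N$ the monic Hahn polynomial $\mathsf Q_\alpha(\cdot;\kappa,N)$ is the unique element of $\mathcal V_{|\alpha|}^d(\mathsf H_{\kappa,N})$ with $\mathsf Q_\alpha-\mathrm m_\alpha\in\Pi_{|\alpha|-1}^d$ (as functions on $\mathbb Z_N^{d+1}$). Hahn polynomials: for $\nu\in\mathbb N_0^d$ with $|\nu|\le N$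 and $x\in\mathbb Z_N^{d+1}$, put $a_j=\sum_{i=j+1}^{d+1}\kappa_i+2\sum_{i=j+1}^{d}\nu_i+d-j$, $M_j=N-\sum_{i<j}x_i-\sum_{i=j+1}^{d}\nu_i$ for $1\le j\le d$, and $$\mathsf H_\nu(x;\kappa,N)=\frac{(-1)^{|\nu|}}{(-N)_{|\nu|}}\prod_{j=1}^d\frac{(\kappa_j+1)_{\nu_j}}{(a_j+1)_{\nu_j}}\sum_{k=0}^{\nu_j}\frac{(-\nu_j)_k(\nu_j+\kappa_j+a_j+1)_k(-x_j)_k}{(\kappa_j+1)_k\,k!}\,(-M_j+k)_{\nu_j-k}.$$ The $\mathsf H_\nu(\cdot;\kappa,N)$, $|\nu|=n$, form a mutually orthogonal basis of $\mathcal V_n^d(\mathsf H_{\kappa,N})$; $\mathsf B_\nu(\kappa,N)=\langle\mathsf H_\nu(\cdot;\kappa,N),\mathsf H_\nu(\cdot;\kappa,N)\rangle_{\mathsf H_{\kappa,N}}$. *)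

(* Defs.v *)
From HB Require Import structures.
From mathcomp Require Import all_boot all_order all_algebra.
From mathcomp Require Import classical_sets reals.
From mathcomp Require Import mpoly.

Set Implicit Arguments.
Unset Strict Implicit.
Unset Printing Implicit Defensive.

Import GRing.Theory.
Local Open Scope ring_scope.

Definition poch (R : pzRingType) (a : R) (n : nat) : R :=
  \prod_(i < n) (a + i%:R).

Definition mpoch (R : comPzRingType) (k : nat) (y : 'I_k -> R)
    (alpha : 'X_{1..k}) : R :=
  \prod_(i < k) poch (y i) (alpha i).

Definition mnm_fact (k : nat) (alpha : 'X_{1..k}) : nat :=
  (\prod_(i < k) (alpha i)`!)%N.

(* The set of alpha in N_0^k with |alpha| = N. *)
Record simplex (k N : nat) := Simplex {
  simplex_mnm :> 'X_{1..k < N.+1};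
  _ : mdeg simplex_mnm == N
}.

HB.instance Definition _ k N := [isSub for @simplex_mnm k N].
HB.instance Definition _ k N := [Finite of simplex k N by <:].

Definition emb (d : nat) : 'I_d -> 'I_d.+1 := widen_ord (leqnSn d).

(* Coordinates are numbered from 0, so formulas usually written for 1 <= j <= d
   are used at j.+1; hence d - j.+1 in [hahn_a]. *)
Section Hahn.
Variables (R : realType) (d : nat) (kappa : 'I_d.+1 -> R) (N : nat).

Definition hahn_a (nu : 'X_{1..d}) (j : 'I_d) : R :=
  \sum_(i < d.+1 | (j < i)%N) kappa i
  + 2%:R * (\sum_(i < d | (j < i)%N) nu i)%N%:R + (d - j.+1)%:R.

(* A subtraction in R: it must not be truncated. *)
Definition hahn_M (nu : 'X_{1..d}) (x : 'X_{1..d.+1}) (j : 'I_d) : R :=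
  N%:R - (\sum_(i < d.+1 | (i < j)%N) x i)%N%:R
       - (\sum_(i < d | (j < i)%N) nu i)%N%:R.

Definition hahn (nu : 'X_{1..d}) (x : 'X_{1..d.+1}) : R :=
  (-1) ^+ mdeg nu / poch (- N%:R) (mdeg nu) *
  \prod_(j < d)
    (poch (kappa (emb j) + 1) (nu j) / poch (hahn_a nu j + 1) (nu j) *
     \sum_(k < (nu j).+1)
       poch (- (nu j)%:R) k
       * poch ((nu j)%:R + kappa (emb j) + hahn_a nu j + 1) k
       * poch (- (x (emb j))%:R) k
       / (poch (kappa (emb j) + 1) k * k`!%:R)
       * poch (- hahn_M nu x j + k%:R) (nu j - k)).

Definition hahn_inner (f g : simplex d.+1 N -> R) : R :=
  N`!%:R / poch (\sum_i kappa i + d%:R + 1) N *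
  \sum_(x : simplex d.+1 N)
    f x * g x * (mpoch (fun i => kappa i + 1) x / (mnm_fact x)%:R).

Definition hahn_norm (nu : 'X_{1..d}) : R :=
  hahn_inner (fun x => hahn nu x) (fun x => hahn nu x).

(* [polyfun k] is Pi_{k-1}^d, seen as functions on Z_N^{d+1}: [msize p] is
   deg p + 1, and [msize p <= 0] means p = 0. *)
Definition polyfun (k : nat) (f : {ffun simplex d.+1 N -> R}) : Prop :=
  exists2 p : {mpoly R[d]}, (msize p <= k)%N &
    forall x : simplex d.+1 N, f x = p.@[fun i : 'I_d => (x (emb i))%:R].

Definition hahn_space (n : nat) (f : {ffun simplex d.+1 N -> R}) : Prop :=
  polyfun n.+1 f /\
  forall g : {ffun simplex d.+1 N -> R}, polyfun n g -> hahn_inner f g = 0.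

Definition hahn_m (alpha : 'X_{1..d.+1}) : {ffun simplex d.+1 N -> R} :=
  [ffun x : simplex d.+1 N =>
     (-1) ^+ mdeg alpha * mpoch (fun i => - (x i)%:R) alpha].

Definition is_monic_hahn (alpha : 'X_{1..d.+1})
    (q : {ffun simplex d.+1 N -> R}) : Prop :=
  hahn_space (mdeg alpha) q /\ polyfun (mdeg alpha) (q - hahn_m alpha).

(* For |alpha| <= N and kappa_i > -1 there is exactly one such function; the
   default value 0 is then irrelevant. *)
Definition monic_hahn (alpha : 'X_{1..d.+1}) : {ffun simplex d.+1 N -> R} :=
  xget 0 (is_monic_hahn alpha).

End Hahn.

(* Main.v *)
(* Three facts drive the proof.
   (1) Orthogonality. Summing out the coordinates one at a time, starting from
   the last ones, reduces the orthogonality of the H_nu on every Z_N^{d+1} to the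
   one-variable case; there, testing against the shifted factorials
   (b + M - x)_l turns the moments into a Chu-Vandermonde sum. Counting
   dimensions, the H_nu with |nu| < k then form a basis of Pi_{k-1}.
   (2) Homogeneity. With N replaced by |x|, the numerator of H_nu is a linear
   combination of the m_alpha with |alpha| = |nu| exactly, because
   (|alpha| - |x|) m_alpha is a combination of the m_{alpha+e_i}. As m_alpha is
   alpha! times the Kronecker delta on Z_n, the coefficients are the values on
   Z_n divided by alpha!.
   (3) Let T g = sum_beta g(beta)/beta! Q_beta, for g a function on Z_n. By (2),
   T maps H_nu(.;kappa,n) to a multiple of H_nu(.;kappa,N) if |nu| = n, which is
   the first identity, and to 0 if |nu| < n. Applying T to the expansion of a
   Kronecker delta in the basis H_nu(.;kappa,n) gives the second identity. *)
Require Import Defs.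
From mathcomp Require Import all_boot all_order all_algebra.
From mathcomp Require Import classical_sets reals ring lra zify.
From mathcomp Require Import mpoly.

Set Implicit Arguments.
Unset Strict Implicit.
Unset Printing Implicit Defensive.

Import Order.TTheory GRing.Theory Num.Theory.
Local Open Scope ring_scope.

(** * One-variable Hahn polynomials *)

Section Pochhammer.
Variable R : comPzRingType.
Implicit Types a b c : R.

Lemma poch0 a : poch a 0 = 1.
Proof. by rewrite /poch big_ord0. Qed.

Lemma pochSr a n : poch a n.+1 = poch a n * (a + n%:R).
Proof. by rewrite /poch big_ord_recr. Qed.

Lemma pochS a n : poch a n.+1 = a * poch (a + 1) n.
Proof.
rewrite /poch big_ord_recl addr0; congr (_ * _); apply: eq_bigr => i _.
by rewrite lift0 -addrA -[in RHS](natrD _ 1).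
Qed.

Lemma pochD a m n : poch a (m + n) = poch a m * poch (a + m%:R) n.
Proof.
elim: n => [|n IH]; first by rewrite addn0 poch0 mulr1.
by rewrite addnS !pochSr IH natrD -mulrA addrA.
Qed.

Lemma poch_split a m n : (m <= n)%N -> poch a n = poch a m * poch (a + m%:R) (n - m).
Proof. by move=> le_mn; rewrite -pochD subnKC. Qed.

Lemma poch_swap a m n : poch a m * poch (a + m%:R) n = poch a n * poch (a + n%:R) m.
Proof. by rewrite -!pochD addnC. Qed.

Lemma pochN a n : poch (- a) n = (-1) ^+ n * poch (a - n%:R + 1) n.
Proof.
elim: n => [|n IH]; first by rewrite !poch0 mul1r.
rewrite pochSr IH pochS exprS.
have -> : a - n.+1%:R + 1 + 1 = a - n%:R + 1 by rewrite -natr1; ring.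
by rewrite -natr1; ring.
Qed.

Lemma poch_natN_lt m n : (m < n)%N -> poch (- m%:R : R) n = 0.
Proof.
move=> lt_mn; rewrite (poch_split _ lt_mn) pochSr addNr mulr0 mul0r //.
Qed.

Lemma poch_natN m n : poch (- m%:R : R) n = (-1) ^+ n * (m ^_ n)%:R.
Proof.
elim: n => [|n IH]; first by rewrite poch0 mul1r.
rewrite pochSr IH exprS ffactnSr natrM.
have [le_nm|lt_mn] := leqP n m; first by rewrite natrB //; ring.
by rewrite ffact_small //; ring.
Qed.

Lemma poch1 n : poch (1 : R) n = n`!%:R.
Proof.
elim: n => [|n IH]; first by rewrite poch0.
by rewrite pochSr IH factS natrM mulrC nat1r.
Qed.

(** Pascal's rule for a binomial convolution; it drives the induction for Vandermonde's identity. *)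
Lemma sum_binS (f : nat -> nat -> R) n :
  \sum_(k < n.+2) 'C(n.+1, k)%:R * f k (n.+1 - k)%N =
  \sum_(k < n.+1) 'C(n, k)%:R * (f k.+1 (n - k)%N + f k (n - k).+1).
Proof.
rewrite big_ord_recl.
rewrite (eq_bigr (fun k : 'I_n.+1 => 'C(n, k.+1)%:R * f k.+1 (n - k)%N
   + 'C(n, k)%:R * f k.+1 (n - k)%N)); last first.
  by move=> k _; rewrite lift0 binS natrD mulrDl subSS.
rewrite big_split /= addrA [RHS](eq_bigr (fun k : 'I__ =>
   'C(n, k)%:R * f k.+1 (n - k)%N + 'C(n, k)%:R * f k (n.+1 - k)%N)); last first.
  by move=> k _; rewrite mulrDr subSn // -ltnS.
rewrite big_split /= addrC; congr (_ + _).
rewrite [RHS]big_ord_recl big_ord_recr /= (bin_small (ltnSn n)) mul0r addr0.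
by rewrite !bin0; congr (_ + _); apply: eq_bigr => k _; rewrite lift0 subSS.
Qed.

Lemma poch_vandermonde a b n :
  \sum_(k < n.+1) 'C(n, k)%:R * (poch a k * poch b (n - k)) = poch (a + b) n.
Proof.
elim: n => [|n IH]; first by rewrite big_ord_recl big_ord0 /= bin0 !poch0; ring.
(* The new factor a + b + n is (a + k) + (b + n - k), one summand for each term coming from Pascal's
   rule. *)
rewrite (sum_binS (fun i j => poch a i * poch b j)) pochSr -IH mulr_suml.
apply: eq_bigr => k _; rewrite !pochSr natrB -1?ltnS //; ring.
Qed.

(** Reflecting (c + k)_(n - k) into (-1)^(n - k) (1 - c - n)_(n - k) makes all signs equal and
    leaves Vandermonde's sum for p and 1 - c - n. *)
Lemma poch_chu p c n :
  \sum_(k < n.+1) (-1) ^+ k * 'C(n, k)%:R * poch p k * poch (c + k%:R) (n - k)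
  = poch (c - p) n.
Proof.
rewrite -[c - p]opprB pochN.
have -> : p - c - n%:R + 1 = p + (1 - c - n%:R) by ring.
rewrite -poch_vandermonde mulr_sumr; apply: eq_bigr => k _.
have le_kn : (k <= n)%N by rewrite -ltnS.
have -> : c + k%:R = - (- c - k%:R) by ring.
rewrite pochN natrB //.
have -> : - c - k%:R - (n%:R - k%:R) + 1 = 1 - c - n%:R by ring.
have -> : (-1) ^+ n = (-1) ^+ k * (-1) ^+ (n - k) :> R by rewrite -exprD subnKC.
ring.
Qed.

End Pochhammer.

(** * Moments and orthogonality in one variable *)

Section Univariate.
Variable R : realFieldType.
Implicit Types a b c : R.

Lemma poch_gt0 a n : 0 < a -> 0 < poch a n.
Proof. by move=> a0; apply: prodr_gt0 => i _; rewrite ltr_wpDr. Qed.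

Lemma poch_neq0 a n : 0 < a -> poch a n != 0.
Proof. by move=> a0; rewrite gt_eqF ?poch_gt0. Qed.

Lemma factr_neq0 n : n`!%:R != 0 :> R.
Proof. by rewrite pnatr_eq0 -lt0n fact_gt0. Qed.

Lemma poch_natN_fact m n : (n <= m)%N ->
  poch (- m%:R : R) n = (-1) ^+ n * m`!%:R / (m - n)`!%:R.
Proof.
move=> le_nm; rewrite poch_natN -mulrA; congr (_ * _).
by rewrite -(ffact_fact le_nm) natrM mulfK ?factr_neq0.
Qed.

(** Up to normalisation, the beta-binomial distribution. *)
Definition hahn_wt a b (M x : nat) : R :=
  poch a x / x`!%:R * (poch b (M - x) / (M - x)`!%:R).

Lemma sum_hahn_wt a b M :
  \sum_(x < M.+1) hahn_wt a b M x = poch (a + b) M / M`!%:R.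
Proof.
rewrite -poch_vandermonde mulr_suml; apply: eq_bigr => x _.
have le_xM : (x <= M)%N by rewrite -ltnS.
rewrite -(bin_fact le_xM) !natrM /hahn_wt.
have ? : 'C(M, x)%:R != 0 :> R by rewrite pnatr_eq0 -lt0n bin_gt0.
have := factr_neq0 x; have := factr_neq0 (M - x) => ? ?.
by field; rewrite ?andbT; apply/and3P.
Qed.

(** Since (-x)_k vanishes for x < k, shifting x by k leaves a total mass with parameters a + k, b
    and size M - k. *)
Lemma sum_hahn_wt_poch a b k M : (k <= M)%N ->
  \sum_(x < M.+1) hahn_wt a b M x * poch (- x%:R) k =
  (-1) ^+ k * poch a k * poch (a + b + k%:R) (M - k) / (M - k)`!%:R.
Proof.
move=> le_kM; rewrite -(big_mkord xpredT (fun x => hahn_wt a b M x * poch (- x%:R) k)).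
rewrite (@big_cat_nat _ _ _ k) ?leq0n //=; last exact: leqW.
rewrite big1_seq ?add0r => [|x]; last first.
  by rewrite mem_index_iota => /andP[_ /andP[_ ?]]; rewrite poch_natN_lt ?mulr0.
rewrite -{1}[k]add0n big_addn big_mkord subSn //.
have -> : a + b + k%:R = (a + k%:R) + b by ring.
rewrite -[RHS]mulrA -sum_hahn_wt mulr_sumr; apply: eq_bigr => x _.
rewrite poch_natN_fact ?leq_addl // addnK /hahn_wt [(x + k)%N]addnC pochD subnDA.
have := factr_neq0 (k + x); have := factr_neq0 (M - k - x); have := factr_neq0 x => ? ? ?.
by field; apply/and3P.
Qed.

(* Parameters are shifted by one: a = kappa_j + 1 and b = a_j + 1 in the usual notation. *)
Definition hahn1 a b (n : nat) (M x : R) : R :=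
  \sum_(k < n.+1) poch (- n%:R) k * poch (n%:R + a + b - 1) k * poch (- x) k
    / (poch a k * k`!%:R) * poch (- M + k%:R) (n - k).

(** In each term either x < k and (-x)_k = 0, or k <= x <= M and (k - M)_(n - k) = 0 because M - k <
    n - k. *)
Lemma hahn1_small a b n (M x : nat) : (x <= M < n)%N ->
  hahn1 a b n M%:R x%:R = 0.
Proof.
move=> /andP[le_xM lt_Mn]; apply: big1 => k _.
have [lt_xk|le_kx] := ltnP x k; first by rewrite [poch (- x%:R) k]poch_natN_lt // mulr0 !mul0r.
have -> : - M%:R + k%:R = - (M - k)%:R :> R by rewrite natrB ?(leq_trans le_kx) // opprB addrC.
by rewrite [X in _ * X]poch_natN_lt ?mulr0 // ltn_sub2r // (leq_ltn_trans _ lt_Mn) // (leq_trans le_kx).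
Qed.

(** As (b)_(M - x) (b + M - x)_l = (b)_l (b + l)_(M - x), the test function merely changes b into b
    + l in the weight. The factorial moments then leave a Chu-Vandermonde sum equal to (l + 1 -
    n)_n, which vanishes for l < n. *)
Lemma hahn1_moment a b n l M : 0 < a -> (n <= M)%N ->
  \sum_(x < M.+1) hahn_wt a b M x * hahn1 a b n M%:R x%:R * poch (b + M%:R - x%:R) l =
  (-1) ^+ n * poch b l * poch (a + b + l%:R + n%:R) (M - n)
    * poch (l%:R + 1 - n%:R) n / (M - n)`!%:R.
Proof.
move=> a0 le_nM.
transitivity (\sum_(k < n.+1) \sum_(x < M.+1)
   (poch (- n%:R) k * poch (n%:R + a + b - 1) k / (poch a k * k`!%:R)
     * poch (- M%:R + k%:R) (n - k) * poch b l) *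
   (hahn_wt a (b + l%:R) M x * poch (- x%:R) k)).
  rewrite exchange_big; apply: eq_bigr => x _.
  rewrite /hahn1 mulr_sumr mulr_suml; apply: eq_bigr => k _.
  have le_xM : (x <= M)%N by rewrite -ltnS.
  have -> : b + M%:R - x%:R = b + (M - x)%:R by rewrite natrB // addrA.
  have := poch_swap b (M - x) l; rewrite /hahn_wt => E.
  transitivity (poch a x / x`!%:R * ((poch b (M - x) * poch (b + (M - x)%:R) l) / (M - x)`!%:R) *
     (poch (- n%:R) k * poch (n%:R + a + b - 1) k * poch (- x%:R) k
    / (poch a k * k`!%:R) * poch (- M%:R + k%:R) (n - k))); first by ring.
  by rewrite E; ring.
(* This is c - p in [poch_chu], with c = a + b + l and p = n + a + b - 1. *)
have -> : l%:R + 1 - n%:R = (a + b + l%:R) - (n%:R + a + b - 1) by ring.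
rewrite -poch_chu mulr_sumr mulr_suml; apply: eq_bigr => k _.
have le_kn : (k <= n)%N by rewrite -ltnS.
have le_kM := leq_trans le_kn le_nM.
rewrite -mulr_sumr sum_hahn_wt_poch //.
have -> : - M%:R + k%:R = - (M - k)%:R :> R by rewrite natrB // opprB addrC.
rewrite (poch_natN_fact le_kn) (poch_natN_fact (leq_sub2r k le_nM)) subnBA // subnK //.
rewrite -(bin_fact le_kn) !natrM.
(* Cutting (a + b + l + k)_(M - k) after n - k factors isolates (a + b + l + n)_(M - n), which is
   free of k. *)
have -> : (M - k)%N = ((n - k) + (M - n))%N by lia.
rewrite pochD natrB //.
have -> : a + (b + l%:R) + k%:R + (n%:R - k%:R) = a + b + l%:R + n%:R by ring.
have -> : a + (b + l%:R) + k%:R = a + b + l%:R + k%:R by ring.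
have := factr_neq0 (n - k + (M - n)); have := factr_neq0 (n - k).
have := factr_neq0 (M - n); have := factr_neq0 k; have := poch_neq0 k a0 => ? ? ? ? ?.
have -> : (-1) ^+ n = (-1) ^+ k * (-1) ^+ (n - k) :> R by rewrite -exprD subnKC.
by field; apply/and5P.
Qed.

(** Vandermonde with -x = (b + M - x) - (b + M) expands (-x)_k in the test functions of
    [hahn1_moment], of which only l = n contributes. *)
Lemma hahn1_moment0 a b n k M : 0 < a -> (n <= M)%N -> (k <= n)%N ->
  \sum_(x < M.+1) hahn_wt a b M x * hahn1 a b n M%:R x%:R * poch (- x%:R) k =
  if k == n then
    (-1) ^+ n * poch b n * poch (a + b + n.*2%:R) (M - n) * n`!%:R / (M - n)`!%:R
  else 0.
Proof.
move=> a0 le_nM le_kn.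
transitivity (\sum_(l < k.+1) \sum_(x < M.+1)
   'C(k, l)%:R * poch (- (b + M%:R)) (k - l) *
   (hahn_wt a b M x * hahn1 a b n M%:R x%:R * poch (b + M%:R - x%:R) l)).
  rewrite exchange_big; apply: eq_bigr => x _ /=.
  rewrite [in LHS](_ : - x%:R = (b + M%:R - x%:R) + - (b + M%:R) :> R); last by ring.
  rewrite -poch_vandermonde mulr_sumr; apply: eq_bigr => l _; ring.
under eq_bigr => l _ do rewrite -mulr_sumr hahn1_moment //.
have small l : (l < n)%N -> poch (l%:R + 1 - n%:R : R) n = 0.
  move=> lt_ln; have -> : l%:R + 1 - n%:R = - (n - l.+1)%:R :> R.
    by rewrite natrB // -natr1; ring.
  by rewrite poch_natN_lt // ltn_subrL; lia.
case: eqP => [->|/eqP ne_kn]; last first.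
  apply: big1 => l _; rewrite small ?mulr0 ?mul0r ?mulr0 //.
  by rewrite (leq_trans (ltn_ord l)) // ltn_neqAle ne_kn.
rewrite big_ord_recr /= big1 ?add0r => [|l _]; last by rewrite small ?mulr0 ?mul0r ?mulr0.
have -> : n%:R + 1 - n%:R = 1 :> R by ring.
rewrite binn subnn poch0 poch1 -addnn natrD addrA; ring.
Qed.

(** The part of the squared norm that is free of M. The other part is again a total mass, for the
    parameter a + b + 2n and size M - n, so that summation can be iterated over the coordinates. *)
Definition hahn1_norm a b n : R :=
  poch (n%:R + a + b - 1) n / poch a n * poch b n * n`!%:R.

Lemma hahn1_norm_gt0 a b n : 0 < a -> 0 < b -> 0 < hahn1_norm a b n.
Proof.
(* The case n = 0 is separate because a + b - 1 may be negative there. *)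
move=> a0 b0; rewrite /hahn1_norm; case: n => [|n].
  by rewrite !poch0 divr1 !mul1r ltr0n.
have p0 : 0 < n.+1%:R + a + b - 1 by rewrite -natr1; have := ler0n R n; lra.
apply: mulr_gt0; last by rewrite ltr0n fact_gt0.
by apply: mulr_gt0; last exact: poch_gt0; apply: divr_gt0; exact: poch_gt0.
Qed.

Lemma hahn1_orth a b n m M : 0 < a ->
  \sum_(x < M.+1) hahn_wt a b M x * (hahn1 a b n M%:R x%:R * hahn1 a b m M%:R x%:R) =
  if (n == m) && (n <= M)%N then
    hahn1_norm a b n * poch (a + b + n.*2%:R) (M - n) / (M - n)`!%:R
  else 0.
Proof.
move=> a0.
wlog le_mn : n m / (m <= n)%N => [H|].
  have [/H//|/ltnW/H E] := leqP m n.
  under eq_bigr => x _ do rewrite [hahn1 _ _ n _ _ * _]mulrC.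
  by rewrite E eq_sym; case: eqP => // ->.
have [le_nM|lt_Mn] := leqP n M; last first.
  rewrite andbF big1 // => x _.
  by rewrite (@hahn1_small _ _ n) ?mul0r ?mulr0 // lt_Mn andbT -ltnS.
rewrite andbT.
(* The factor of lower degree m is expanded in the (-x)_k with k <= m <= n, so only k = m = n can
   contribute. *)
transitivity (\sum_(k < m.+1)
   poch (- m%:R) k * poch (m%:R + a + b - 1) k / (poch a k * k`!%:R)
     * poch (- M%:R + k%:R) (m - k) *
   \sum_(x < M.+1) (hahn_wt a b M x * hahn1 a b n M%:R x%:R * poch (- x%:R) k)).
  under [RHS]eq_bigr => k _ do rewrite mulr_sumr.
  rewrite exchange_big; apply: eq_bigr => x _ /=.
  rewrite [X in _ * (_ * X)]/hahn1 mulr_sumr mulr_sumr; apply: eq_bigr => k _; ring.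
rewrite (eq_bigr (fun k : 'I_m.+1 => if nat_of_ord k == n then
   poch (- m%:R) k * poch (m%:R + a + b - 1) k / (poch a k * k`!%:R)
     * poch (- M%:R + k%:R) (m - k) *
    ((-1) ^+ n * poch b n * poch (a + b + n.*2%:R) (M - n) * n`!%:R / (M - n)`!%:R)
   else 0)); last first.
  move=> k _; rewrite hahn1_moment0 // ?(leq_trans _ le_mn) -1?ltnS //.
  by case: eqP; rewrite ?mulr0.
case: eqP => [<-|ne]; last first.
  by rewrite big1 // => k _; case: eqP => // E; case: ne; have := ltn_ord k; lia.
rewrite big_ord_recr /= big1 ?add0r => [|k _]; last by rewrite ltn_eqF.
rewrite eqxx subnn poch0 poch_natN_fact // subnn fact0 /hahn1_norm.
have -> : (-1) ^+ n * n`!%:R / 1%:R = (-1) ^+ n * n`!%:R :> R by rewrite divr1.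
have := poch_neq0 n a0; have := factr_neq0 n; have := factr_neq0 (M - n) => ? ? ?.
transitivity ((-1) ^+ n * (-1) ^+ n * (poch (n%:R + a + b - 1) n / poch a n * poch b n * n`!%:R *
  poch (a + b + n.*2%:R) (M - n) / (M - n)`!%:R)); first by field; apply/and3P.
by rewrite -exprD addnn -signr_odd odd_double mul1r.
Qed.

End Univariate.

(** * Orthogonality in several variables *)

(* The sequences of length k.+1 (not k) with sum N. *)
Fixpoint weak_comps (k N : nat) : seq (seq nat) :=
  if k is k'.+1 then [seq x :: xs | x <- iota 0 N.+1, xs <- weak_comps k' (N - x)]
  else [:: [:: N]].

Lemma mem_weak_comps k N s :
  (s \in weak_comps k N) = (size s == k.+1) && (sumn s == N).
Proof.
elim: k N s => [|k IH] N s.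
  rewrite inE; case: s => [|x [|y s]] //=; last by rewrite eqseq_cons andbF.
  by rewrite addn0 eqseq_cons andbT.
apply/allpairsPdep/andP => [[x [xs [/[!mem_iota] lt_xN + ->]]]|].
  rewrite IH => /andP[/eqP /= -> /eqP ->]; split=> //; apply/eqP.
  by rewrite subnKC //; move: lt_xN; rewrite add0n ltnS.
case: s => [[]|x s] //= [ss /eqP E]; exists x, s; split=> //.
  by rewrite -[_ :: _]/(iota 0 N.+1) mem_iota /= add0n ltnS -E leq_addr.
by rewrite IH -eqSS ss -E addKn eqxx.
Qed.

Lemma uniq_weak_comps k N : uniq (weak_comps k N).
Proof.
elim: k N => [|k IH] N //; apply: allpairs_uniq_dep => //; first exact: iota_uniq.
by move=> [x xs] [y ys] _ _ /= [-> ->].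
Qed.

Lemma big_weak_comps (V : nmodType) k m (F : seq nat -> V) :
  \sum_(s <- weak_comps k.+1 m) F s =
  \sum_(x < m.+1) \sum_(xs <- weak_comps k (m - x)) F (nat_of_ord x :: xs).
Proof.
rewrite -(big_mkord xpredT (fun x => \sum_(xs <- weak_comps k (m - x)) F (x :: xs))).
by rewrite /index_iota subn0 -big_allpairs_dep.
Qed.

Section SeqHahn.
Variable R : realFieldType.

(* a lists the kappa_i + 1. Since |x| = N, the paper's N - (x_1 + ... + x_{j-1}) is the
   sum of the remaining coordinates, which makes the product recursive. *)
Fixpoint hahn_seq (a : seq R) (nu xs : seq nat) : R :=
  match a, nu, xs with
  | a0 :: a', n :: nu', x :: xs' =>
      hahn1 a0 (\sum_(b <- a') b + (sumn nu').*2%:R) n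
        ((x + sumn xs')%:R - (sumn nu')%:R) x%:R * hahn_seq a' nu' xs'
  | _, _, _ => 1
  end.

Fixpoint wt_seq (a : seq R) (xs : seq nat) : R :=
  match a, xs with
  | a0 :: a', x :: xs' => poch a0 x / x`!%:R * wt_seq a' xs'
  | _, _ => 1
  end.

(** Induction on the length. For the tail [nu], the sum at total m - x supplies the second factor of
    [hahn_wt] of size m - |nu|; the sum over the head x is then one-variable orthogonality. C is
    chosen before m because the tail total m - x varies with x. *)
Lemma hahn_seq_orth (a : seq R) (nu : seq nat) :
  size a = (size nu).+1 -> all (fun b => 0 < b) a ->
  exists2 C : R, 0 < C & forall (mu : seq nat) m, size mu = size nu ->
    \sum_(xs <- weak_comps (size nu) m)
      wt_seq a xs * (hahn_seq a nu xs * hahn_seq a mu xs) =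
    if (nu == mu) && (sumn nu <= m)%N then
      C * poch (\sum_(b <- a) b + (sumn nu).*2%:R) (m - sumn nu) / (m - sumn nu)`!%:R
    else 0.
Proof.
elim: nu a => [|n nu IH] [|a0 a] //=.
  case: a => // _ _; exists 1 => // -[|//] m _ /=.
  by rewrite !big_seq1 subn0 /= addr0 !mulr1 mul1r.
move=> [sa] /andP[a0_gt0 a_gt0]; have [C C_gt0 HC] := IH _ sa a_gt0.
pose b := \sum_(b <- a) b + (sumn nu).*2%:R.
have b_gt0 : 0 < b.
  rewrite ltr_wpDr //; case: a sa a_gt0 {IH HC b} => // c a _ /= /andP[c0 a_gt0].
  rewrite big_cons ltr_wpDr //; elim: a a_gt0 => [|e a IH]; first by rewrite big_nil.
  by move=> /andP[e0 /IH H]; rewrite big_cons addr_ge0 // ltW.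
exists (C * hahn1_norm a0 b n); first by rewrite mulr_gt0 ?hahn1_norm_gt0.
case=> [//|n' mu] m [smu]; rewrite [size _]/= big_weak_comps.
pose c n1 nu1 (x : nat) := hahn1 a0 (\sum_(b <- a) b + (sumn nu1).*2%:R) n1
    (m%:R - (sumn nu1)%:R) x%:R.
transitivity (\sum_(x < m.+1) poch a0 x / x`!%:R * (c n nu x * c n' mu x) *
   if (nu == mu) && (sumn nu <= m - x)%N then
     C * poch b (m - x - sumn nu) / (m - x - sumn nu)`!%:R
   else 0).
  apply: eq_bigr => x _; rewrite -HC // mulr_sumr big_seq [RHS]big_seq; apply: eq_bigr => xs.
  rewrite mem_weak_comps => /andP[_ /eqP E] /=; rewrite E subnKC -1?ltnS // /c; ring.
rewrite eqseq_cons; case: (nu =P mu) => [<-|_]; last first.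
  by rewrite andbF; apply: big1 => x _; rewrite mulr0.
rewrite andbT /=; have [le_m|lt_m] := leqP (sumn nu) m; last first.
  rewrite [(_ + _ <= _)%N]leqNgt (leq_trans lt_m (leq_addl _ _)) andbF.
  by apply: big1 => x _; rewrite leqNgt (leq_ltn_trans (leq_subr _ _) lt_m) mulr0.
have [M defM] : {M | M = (m - sumn nu)%N} by exists (m - sumn nu)%N.
have EM : m%:R - (sumn nu)%:R = M%:R :> R by rewrite defM natrB.
transitivity (C * \sum_(x < M.+1) hahn_wt a0 b M x *
    (hahn1 a0 b n M%:R x%:R * hahn1 a0 b n' M%:R x%:R)).
  rewrite -(big_mkord xpredT (fun x => poch a0 x / x`!%:R * (c n nu x * c n' nu x) *
    (if (sumn nu <= m - x)%N then
      C * poch b (m - x - sumn nu) / (m - x - sumn nu)`!%:R else 0))).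
  (* For x > M the tail total m - x is below |nu| and the tail sum vanishes. *)
  rewrite (@big_cat_nat _ _ _ M.+1) //=; last by rewrite defM ltnS leq_subr.
  rewrite [X in _ + X]big1_seq ?addr0; last first.
    move=> x; rewrite mem_index_iota => /andP[_ /andP[]] => lt_Mx lt_xm.
    by rewrite leqNgt ifF ?mulr0 //; apply/negbTE; rewrite negbK; lia.
  rewrite big_mkord mulr_sumr; apply: eq_bigr => x _.
  have le_xM : (x <= M)%N by rewrite -ltnS.
  rewrite ifT; last by lia.
  rewrite /c EM -/b /hahn_wt subnAC -defM; ring.
rewrite hahn1_orth // big_cons.
have -> : (n + sumn nu <= m)%N = (n <= M)%N by lia.
case: ifP => [/andP[_ le_nM]|_]; last by rewrite mulr0.
have -> : (m - (n + sumn nu))%N = (M - n)%N by lia.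
have -> : a0 + \sum_(b <- a) b + (n + sumn nu).*2%:R = a0 + b + n.*2%:R.
  by rewrite doubleD natrD /b; ring.
by rewrite !mulrA.
Qed.

End SeqHahn.

Lemma nth_map_enum_ord (T : Type) (x0 : T) n (f : 'I_n -> T) (i : 'I_n) :
  nth x0 [seq f j | j <- enum 'I_n] i = f i.
Proof. by rewrite (nth_map i) ?size_enum_ord // nth_ord_enum. Qed.

Lemma big_drop (T : Type) (idx : T) (op : Monoid.law idx) n j (s : seq T) :
  size s = n ->
  \big[op/idx]_(b <- drop j s) b = \big[op/idx]_(i < n | (j <= i)%N) nth idx s i.
Proof.
move=> <-; rewrite (big_nth idx) size_drop.
rewrite -(big_geq_mkord j _ xpredT).
rewrite -{3}[j]add0n big_addn; apply: eq_bigr => i _.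
by rewrite nth_drop addnC.
Qed.

Section Bridge.
Variable R : realFieldType.

Lemma hahn_seqE (a : seq R) (nu xs : seq nat) :
  size a = (size nu).+1 -> size xs = (size nu).+1 ->
  hahn_seq a nu xs = \prod_(j < size nu)
    hahn1 (nth 0 a j) (\sum_(b <- drop j.+1 a) b + (sumn (drop j.+1 nu)).*2%:R)
      (nth 0%N nu j) ((sumn (drop j xs))%:R - (sumn (drop j.+1 nu))%:R) (nth 0%N xs j)%:R.
Proof.
elim: nu a xs => [|n nu IH] [|a0 a] [|x xs] //=; first by rewrite big_ord0.
move=> [sa] [sx]; rewrite big_ord_recl /= !drop0 IH //; congr (_ * _).
Qed.

Lemma wt_seqE (a : seq R) (xs : seq nat) :
  size xs = size a ->
  wt_seq a xs = \prod_(j < size a) (poch (nth 0 a j) (nth 0%N xs j) / (nth 0%N xs j)`!%:R).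
Proof.
elim: a xs => [|a0 a IH] [|x xs] //=; first by rewrite big_ord0.
by move=> [sx]; rewrite big_ord_recl /= IH.
Qed.

End Bridge.

Lemma mdeg_simplex k N (x : simplex k N) : mdeg x = N.
Proof. by apply/eqP; case: x. Qed.

Lemma big_simplex (V : nmodType) k N (F : seq nat -> V) :
  \sum_(x : simplex k.+1 N) F (x : 'X_{1..k.+1}) = \sum_(s <- weak_comps k N) F s.
Proof.
pose toseq (x : simplex k.+1 N) : seq nat := (x : 'X_{1..k.+1}).
rewrite -[LHS]big_enum -(big_map toseq xpredT); apply: perm_big.
apply: uniq_perm; [|exact: uniq_weak_comps|move=> s].
  rewrite map_inj_uniq ?enum_uniq // => x y E.
  (* The four layers are the simplex, the bounded multinomial, the multinomial and the tuple. *)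
  by apply/val_inj/val_inj/val_inj/val_inj.
rewrite mem_weak_comps; apply/mapP/andP => [[x _ ->]|[/eqP ss /eqP sN]].
  rewrite size_tuple eqxx; split=> //; apply/eqP.
  by rewrite -[RHS](mdeg_simplex x) mdegE sumnE (big_nth 0%N) size_tuple big_mkord;
    apply: eq_bigr => i _; rewrite -(mnm_nth 0%N).
pose m : 'X_{1..k.+1} := Multinom (@Tuple _ _ s (introT eqP ss)).
have mN : mdeg m == N by rewrite mdegE -sN sumnE (big_nth 0%N) ss big_mkord; apply/eqP;
  apply: eq_bigr => i _; rewrite (mnm_nth 0%N).
have mN1 : (mdeg m < N.+1)%N by rewrite (eqP mN).
by exists (@Simplex _ _ (BMultinom mN1) mN); rewrite ?mem_enum.
Qed.

(** * Orthogonality transferred from sequences to [hahn] *)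

Section HahnOrth.
Variables (R : realType) (d : nat) (kappa : 'I_d.+1 -> R).
Hypothesis kappa_gt : forall i, -1 < kappa i.

Let a : seq R := [seq kappa i + 1 | i <- enum 'I_d.+1].

(** N enters only through [hahn_M]; putting [mdeg x] for it gives a function on all exponents, the
    one that is homogeneous. *)
Definition hahn_core N (nu : 'X_{1..d}) (x : 'X_{1..d.+1}) : R :=
  \prod_(j < d) hahn1 (kappa (emb j) + 1) (hahn_a kappa nu j + 1) (nu j)
    (hahn_M R N nu x j) (x (emb j))%:R.

Definition hahn_coef (nu : 'X_{1..d}) : R :=
  \prod_(j < d) (poch (kappa (emb j) + 1) (nu j) / poch (hahn_a kappa nu j + 1) (nu j)).

Definition hahn_scale N (nu : 'X_{1..d}) : R :=
  (-1) ^+ mdeg nu / poch (- N%:R) (mdeg nu) * hahn_coef nu.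

Lemma hahnE N nu x : hahn kappa N nu x = hahn_scale N nu * hahn_core N nu x.
Proof.
rewrite /hahn /hahn_scale -[RHS]mulrA /hahn_coef /hahn_core -big_split /=; congr (_ * _); apply: eq_bigr => j _.
congr (_ * _); apply: eq_bigr => k _; do 4 congr (_ * _).
by congr poch; ring.
Qed.

(** The constant of [hahn_a] plus 1 is the number of indices above j, one unit for each
    [kappa i]. *)
Lemma hahn_aE nu (j : 'I_d) :
  hahn_a kappa nu j + 1 =
  \sum_(i < d.+1 | (j < i)%N) (kappa i + 1) + (\sum_(i < d | (j < i)%N) nu i)%N.*2%:R.
Proof.
rewrite /hahn_a big_split /= sumr_const.
have -> : #|[pred i : 'I_d.+1 | (j < i)%N]| = (d - j.+1).+1.
  rewrite -sum1_card -(big_geq_mkord j.+1 _ xpredT (fun=> 1%N)).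
  by rewrite sum_nat_const_nat muln1 subSn.
by rewrite -natr1 -muln2 natrM; ring.
Qed.

Lemma hahn_core_seq N (nu : 'X_{1..d}) (x : 'X_{1..d.+1}) :
  mdeg x = N -> hahn_core N nu x = hahn_seq a nu x.
Proof.
move=> xN; have sza : size a = d.+1 by rewrite size_map size_enum_ord.
rewrite hahn_seqE ?sza ?size_tuple //; apply: eq_bigr => j _.
have -> : nth 0 a j = kappa (emb j) + 1.
  by rewrite -[nat_of_ord j]/(nat_of_ord (emb j)) nth_map_enum_ord.
have nuj : sumn (drop j.+1 nu) = (\sum_(i < d | (j < i)%N) nu i)%N.
  rewrite sumnE (big_drop _ _ (size_tuple _)); apply: eq_bigr => i _.
  by rewrite -(mnm_nth 0%N).
have -> : nth 0%N x j = x (emb j) by rewrite (mnm_nth 0%N).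
rewrite hahn_aE nuj -(mnm_nth 0%N).
congr hahn1.
  congr (_ + _); rewrite (big_drop _ _ sza).
  by apply: eq_bigr => i _; rewrite nth_map_enum_ord.
rewrite /hahn_M; congr (_ - _).
rewrite sumnE (big_drop _ _ (size_tuple _)) -xN mdegE.
rewrite (bigID (fun i : 'I_d.+1 => (i < j)%N)) /= natrD addrAC subrr add0r.
congr (_%:R); apply: eq_big => [i|i _]; first by rewrite -leqNgt.
by rewrite -(mnm_nth 0%N).
Qed.

Definition hahn_w (x : 'X_{1..d.+1}) : R :=
  mpoch (fun i => kappa i + 1) x / (mnm_fact x)%:R.

Lemma hahn_w_gt0 x : 0 < hahn_w x.
Proof.
apply: divr_gt0; first by apply: prodr_gt0 => i _; apply: poch_gt0; have := kappa_gt i; lra.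
by rewrite ltr0n prodn_gt0 // => i; rewrite fact_gt0.
Qed.

Lemma hahn_w_seq x : hahn_w x = wt_seq a x.
Proof.
have sza : size a = d.+1 by rewrite size_map size_enum_ord.
rewrite wt_seqE ?sza ?size_tuple //.
rewrite /hahn_w /mpoch /mnm_fact natr_prod -prodf_div; apply: eq_bigr => i _.
by rewrite nth_map_enum_ord -(mnm_nth 0%N).
Qed.

Lemma hahn_a_gt nu (j : 'I_d) : 0 < hahn_a kappa nu j + 1.
Proof.
rewrite hahn_aE ltr_wpDr // (bigD1 ord_max) //=.
rewrite ltr_wpDr ?sumr_ge0 // => [i _|]; have := kappa_gt ord_max; last by lra.
by have := kappa_gt i; lra.
Qed.

Lemma hahn_coef_gt0 nu : 0 < hahn_coef nu.
Proof.
apply: prodr_gt0 => j _; apply: divr_gt0; apply: poch_gt0; last exact: hahn_a_gt.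
by have := kappa_gt (emb j); lra.
Qed.

Lemma hahn_scale_neq0 N nu : (mdeg nu <= N)%N -> hahn_scale N nu != 0.
Proof.
move=> le_nuN; apply: mulf_neq0; last by rewrite gt_eqF ?hahn_coef_gt0.
rewrite poch_natN_fact // mulf_neq0 ?signr_eq0 // invr_eq0.
by rewrite !mulf_neq0 ?invr_eq0 ?signr_eq0 ?factr_neq0.
Qed.

Lemma sum_kappa_gt : 0 < \sum_i kappa i + d%:R + 1.
Proof.
have -> : \sum_i kappa i + d%:R + 1 = \sum_i (kappa i + 1).
  by rewrite big_split /= sumr_const card_ord -natr1 addrA.
rewrite big_ord_recl ltr_wpDr ?sumr_ge0 // => [i _|].
  by have := kappa_gt (lift ord0 i); lra.
by have := kappa_gt ord0; lra.
Qed.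

Lemma sum_hahn_core nu : exists2 C : R, 0 < C & forall mu N,
  \sum_(x : simplex d.+1 N) hahn_w x * (hahn_core N nu x * hahn_core N mu x) =
  if (nu == mu) && (mdeg nu <= N)%N then
    C * poch (\sum_i (kappa i + 1) + (mdeg nu).*2%:R) (N - mdeg nu) / (N - mdeg nu)`!%:R
  else 0.
Proof.
have sa : size a = (size nu).+1 by rewrite size_map size_enum_ord size_tuple.
have a_gt0 : all (fun b => 0 < b) a.
  by apply/allP => _ /mapP[i _ ->]; have := kappa_gt i; lra.
have [C C_gt0 HC] := hahn_seq_orth sa a_gt0; exists C => // mu N.
transitivity (\sum_(x : simplex d.+1 N) wt_seq a (x : 'X_{1..d.+1}) *
   (hahn_seq a nu (x : 'X_{1..d.+1}) * hahn_seq a mu (x : 'X_{1..d.+1}))).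
  by apply: eq_bigr => x _; rewrite hahn_w_seq !hahn_core_seq // mdeg_simplex.
rewrite (big_simplex _ _ (fun s => wt_seq a s * (hahn_seq a nu s * hahn_seq a mu s))).
have {1}-> : d = size nu by rewrite size_tuple.
rewrite HC ?size_tuple // big_map big_enum /=.
have -> : sumn nu = mdeg nu by rewrite sumnE.
by [].
Qed.

End HahnOrth.

(** * Homogeneous combinations of falling factorials *)

Section Homogeneous.
Variables (R : realFieldType) (k : nat).
Implicit Types (f g : 'X_{1..k} -> R) (alpha x : 'X_{1..k}).

Definition fall alpha x : R := mpoch (fun i => - (x i)%:R) alpha.

Lemma fallD alpha i m x :
  fall (alpha + U_(i) *+ m)%MM x = fall alpha x * poch (- (x i)%:R + (alpha i)%:R) m.
Proof.
rewrite /fall /mpoch (bigD1 i) //= [in RHS](bigD1 i) //= mnmDE mulmnE mnm1E eqxx mul1n.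
rewrite pochD mulrAC; congr (_ * _ * _); apply: eq_bigr => l ne_li.
by rewrite mnmDE mulmnE mnm1E eq_sym (negbTE ne_li) addn0.
Qed.

(* Span of the falling factorials of degree p in the variables of index at least j. *)
Inductive fhom (j p : nat) : ('X_{1..k} -> R) -> Prop :=
| fhom_mon alpha : mdeg alpha = p -> (forall i : 'I_k, (i < j)%N -> alpha i = 0%N) ->
    fhom j p (fall alpha)
| fhom0 : fhom j p (fun=> 0)
| fhomD f g : fhom j p f -> fhom j p g -> fhom j p (fun x => f x + g x)
| fhomZ c f : fhom j p f -> fhom j p (fun x => c * f x)
| fhom_ext f g : f =1 g -> fhom j p f -> fhom j p g.

Lemma fhom_sum j p (I : Type) (r : seq I) (P : pred I) (F : I -> 'X_{1..k} -> R) :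
  (forall i, P i -> fhom j p (F i)) -> fhom j p (fun x => \sum_(i <- r | P i) F i x).
Proof.
move=> FP; elim: r => [|i r IH].
  by apply: fhom_ext (fhom0 _ _) => x; rewrite big_nil.
have [Pi|nPi] := boolP (P i).
  by apply: fhom_ext (fhomD (FP i Pi) IH) => x; rewrite big_cons Pi.
by apply: fhom_ext IH => x; rewrite big_cons (negbTE nPi).
Qed.

(** One has (-x)_(alpha + e_i) = (-x)_alpha (alpha_i - x_i). Summing over i >= j produces the
    factor, since alpha lives on these indices and has total p. *)
Lemma fhom_mul_tail j p f : fhom j p f ->
  fhom j p.+1 (fun x => f x * (- (\sum_(i < k | (j <= i)%N) x i)%N%:R + p%:R)).
Proof.
elim=> [alpha dega suppa||f1 f2 _ IH1 _ IH2|c f1 _ IH|f1 f2 E _ IH].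
- have: fhom j p.+1 (fun x => \sum_(i < k | (j <= i)%N) fall (alpha + U_(i) *+ 1)%MM x).
    apply: fhom_sum => i le_ji; apply: fhom_mon => [|l lt_lj].
      by rewrite mdegD mdegMn mdeg1 dega addn1.
    rewrite mnmDE mulmnE mnm1E suppa //; case: eqP => // E.
    by rewrite E leqNgt lt_lj in le_ji.
  apply: fhom_ext => x; under eq_bigr => i _ do rewrite fallD /poch big_ord1 addr0.
  rewrite -mulr_sumr big_split /= sumrN -!natr_sum -dega mdegE.
  rewrite [X in _ = _ * (_ + X%:R)](bigID (fun i : 'I_k => j <= i)%N) /=.
  by rewrite [X in (_ + X)%N]big1 ?addn0 // => i; rewrite -ltnNge => /suppa.
- by apply: fhom_ext (fhom0 _ _) => x; rewrite mul0r.
- by apply: fhom_ext (fhomD IH1 IH2) => x; rewrite mulrDl.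
- by apply: fhom_ext (fhomZ c IH) => x; rewrite mulrA.
- by apply: fhom_ext IH => x; rewrite E.
Qed.

Lemma fhom_mul_poch j p m f : fhom j p f ->
  fhom j (p + m) (fun x =>
    f x * poch (- (\sum_(i < k | (j <= i)%N) x i)%N%:R + p%:R) m).
Proof.
move=> hf; elim: m => [|m IH].
  by rewrite addn0; apply: fhom_ext hf => x; rewrite poch0 mulr1.
rewrite addnS; apply: fhom_ext (fhom_mul_tail IH) => x.
by rewrite pochSr natrD; ring.
Qed.

(** The generators do not involve x_j, so (-x_j)_m just adds m e_j to their exponents. *)
Lemma fhom_mul_var (j : 'I_k) p m f : fhom j.+1 p f ->
  fhom j (p + m) (fun x => f x * poch (- (x j)%:R) m).
Proof.
elim=> [alpha dega suppa||f1 f2 _ IH1 _ IH2|c f1 _ IH|f1 f2 E _ IH].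
- have : fhom j (p + m) (fall (alpha + U_(j) *+ m)%MM).
    apply: fhom_mon => [|l lt_lj]; first by rewrite mdegD mdegMn mdeg1 dega mul1n.
    rewrite mnmDE mulmnE mnm1E suppa ?(leqW lt_lj) //.
    by case: eqP lt_lj => // ->; rewrite ltnn.
  by apply: fhom_ext => x; rewrite fallD suppa // addr0.
- by apply: fhom_ext (fhom0 _ _) => x; rewrite mul0r.
- by apply: fhom_ext (fhomD IH1 IH2) => x; rewrite mulrDl.
- by apply: fhom_ext (fhomZ c IH) => x; rewrite mulrA.
- by apply: fhom_ext IH => x; rewrite E.
Qed.

(** With equal totals, alpha <= x in every coordinate would force equality; hence some x_i <
    alpha_i, and (-x_i)_(alpha_i) = 0. *)
Lemma fall_eq0 alpha x : mdeg alpha = mdeg x -> alpha != x -> fall alpha x = 0.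
Proof.
move=> deg ne; have [i lt_xa] : exists i, (x i < alpha i)%N.
  apply/existsP; apply: contra_neqT ne => /existsPn H.
  have le i : (alpha i <= x i)%N by rewrite leqNgt.
  apply/mnmP => i; apply/eqP; rewrite eqn_leq le /= -(leq_add2r (\sum_(l < k | l != i) x l)).
  move: deg; rewrite !mdegE (bigD1 i) //= [RHS](bigD1 i) //= => <-.
  by rewrite leq_add2l leq_sum.
by rewrite /fall /mpoch (bigD1 i) //= poch_natN_lt ?mul0r.
Qed.

Lemma fall_diag alpha : fall alpha alpha = (-1) ^+ mdeg alpha * (mnm_fact alpha)%:R.
Proof.
rewrite /mnm_fact natr_prod mdegE expr_sum -big_split; apply: eq_bigr => i _ /=.
by rewrite poch_natN ffactnn.
Qed.

Lemma mnm_fact_neq0 alpha : (mnm_fact alpha)%:R != 0 :> R.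
Proof. by rewrite pnatr_eq0 -lt0n prodn_gt0 // => i; rewrite fact_gt0. Qed.

(** Both sides are linear in f, and for a generator this is the Kronecker property on degree p. The
    point x is of any degree, which permits the passage from Z_n to Z_N. *)
Lemma fhom_expand p f x : fhom 0 p f ->
  f x = \sum_(alpha : simplex k p)
          f alpha / (mnm_fact alpha)%:R * ((-1) ^+ p * fall alpha x).
Proof.
elim=> [beta degb _||f1 f2 _ IH1 _ IH2|c f1 _ IH|f1 f2 E _ IH].
- have pb : mdeg beta == p by rewrite degb.
  have pb1 : (mdeg beta < p.+1)%N by rewrite degb.
  pose b : simplex k p := @Simplex _ _ (BMultinom pb1) pb.
  rewrite (bigD1 b) //= [X in _ + X]big1 ?addr0 => [|alpha ne]; last first.
    rewrite (@fall_eq0 beta) ?mul0r // ?mdeg_simplex //.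
    by apply: contraNneq ne => E; apply/eqP/val_inj/val_inj; rewrite /= E.
  rewrite fall_diag degb; have := mnm_fact_neq0 beta => ?.
  transitivity ((-1) ^+ p * (-1) ^+ p * fall beta x); last by field.
  by rewrite -exprD addnn -signr_odd odd_double mul1r.
- by rewrite big1 // => alpha _; rewrite !mul0r.
- rewrite IH1 IH2 -big_split; apply: eq_bigr => alpha _ /=; ring.
- rewrite IH mulr_sumr; apply: eq_bigr => alpha _ /=; ring.
- by rewrite -E IH; apply: eq_bigr => alpha _; rewrite E.
Qed.

End Homogeneous.

(** * Homogeneity of the Hahn polynomials *)

Section HahnHom.
Variables (R : realType) (d : nat) (kappa : 'I_d.+1 -> R).

Lemma fhom_hahn_core (nu : 'X_{1..d}) :
  fhom 0 (mdeg nu) (fun x => hahn_core kappa (mdeg x) nu x).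
Proof.
(* Induction on the number t of trailing factors: they involve only the variables from d - t on. *)
suff H t : (t <= d)%N -> fhom (d - t) (\sum_(i < d | (d - t <= i)%N) nu i)%N
   (fun x => \prod_(j < d | (d - t <= j)%N)
      hahn1 (kappa (emb j) + 1) (hahn_a kappa nu j + 1) (nu j)
        (hahn_M R (mdeg x) nu x j) (x (emb j))%:R).
  by have := H d (leqnn d); rewrite subnn mdegE.
elim: t => [|t IH] le_td.
  rewrite subn0 big1 => [|i]; last by rewrite leqNgt ltn_ord.
  have := @fhom_mon R d.+1 d 0 0%MM (@mdeg0 d.+1) (fun i _ => mnm0E i).
  apply: fhom_ext => x; rewrite big1 => [|i]; last by rewrite leqNgt ltn_ord.
  by rewrite /fall /mpoch big1 // => i _; rewrite mnm0E poch0.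
have lt_jd : (d - t.+1 < d)%N by lia.
pose j := Ordinal lt_jd.
have jE : (d - t)%N = j.+1 by rewrite /= subnSK.
have := IH (ltnW le_td); rewrite jE -[(d - t.+1)%N]/(nat_of_ord j).
set p := (\sum_(i < d | _) _)%N; set f := (fun x : 'X_{1..d.+1} => _) => hf.
have splitj (P : nat -> bool) (i : 'I_d) : (j <= i)%N && (i != j) = (j < i)%N.
  by rewrite ltn_neqAle eq_sym andbC.
rewrite (bigD1 j) //= (eq_bigl _ _ (splitj xpredT)) -/p addnC.
(* With |x| for N, -M_j + k is minus the sum of the variables from j on, plus p + k. This is the
   shift that [fhom_mul_poch] requires after (-x_j)_k has raised the degree to p + k. *)
have H (x : 'X_{1..d.+1}) : (\sum_(i < d.+1 | (emb j <= i)%N) x i)%N%:R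
     = (mdeg x)%:R - (\sum_(i < d.+1 | (i < j)%N) x i)%N%:R :> R.
  rewrite mdegE [X in _ = X%:R - _](bigID (fun i : 'I_d.+1 => i < j)%N) /= natrD addrAC subrr add0r.
  by congr (_%:R); apply: eq_bigl => i; rewrite -leqNgt.
have := @fhom_sum R d.+1 j (p + nu j) _ (index_enum 'I_(nu j).+1) xpredT
  (fun k x => poch (- (nu j)%:R) k *
     poch ((nu j)%:R + (kappa (emb j) + 1) + (hahn_a kappa nu j + 1) - 1) k /
     (poch (kappa (emb j) + 1) k * k`!%:R) *
     (f x * poch (- (x (emb j))%:R) k *
      poch (- (\sum_(i < d.+1 | (emb j <= i)%N) x i)%N%:R + (p + k)%:R) (nu j - k))).
have hk (k : 'I_(nu j).+1) : fhom j (p + nu j)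
   (fun x => f x * poch (- (x (emb j))%:R) k *
      poch (- (\sum_(i < d.+1 | (emb j <= i)%N) x i)%N%:R + (p + k)%:R) (nu j - k)).
  have le_k : (k <= nu j)%N by rewrite -ltnS.
  have := @fhom_mul_var R d.+1 (emb j) p k f hf => /(@fhom_mul_poch _ _ _ _ (nu j - k)).
  by rewrite -addnA subnKC.
move=> /(_ (fun k _ => fhomZ _ (hk k))); apply: fhom_ext => x.
rewrite (bigD1 j) //= (eq_bigl _ _ (splitj xpredT)) mulrC -/(f x) /hahn1 mulr_sumr.
apply: eq_bigr => k _; rewrite H.
have -> : - hahn_M R (mdeg x) nu x j + k%:R =
   - ((mdeg x)%:R - (\sum_(i < d.+1 | (i < j)%N) x i)%N%:R) + (p + k)%:R.
  by rewrite /hahn_M /p natrD; ring.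
ring.
Qed.

End HahnHom.

(** * Polynomial functions and inner products *)

Section Exchange.
Variables (F : fieldType) (I : finType) (S : Type).

(* The coefficient matrix C of e in terms of v is square and injective, hence
   invertible. *)
Lemma free_span_exchange (v e : I -> S -> F) (f : S -> F) :
  (forall i, exists c : I -> F, forall x, e i x = \sum_j c j * v j x) ->
  (forall c : I -> F, (forall x, \sum_i c i * e i x = 0) -> forall i, c i = 0) ->
  (exists c : I -> F, forall x, f x = \sum_j c j * v j x) ->
  exists c : I -> F, forall x, f x = \sum_i c i * e i x.
Proof.
move=> /fin_all_exists[c ec] efree [b fb].
pose C := \matrix_(i < #|I|, j < #|I|) c (enum_val i) (enum_val j).
have Cfree : row_free C.
  apply: inj_row_free => u uC0; apply/rowP => i; rewrite mxE.
  pose u' (l : I) := u 0 (enum_rank l).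
  have := efree u' _ (enum_val i); rewrite /u' enum_valK; apply=> x.
  under eq_bigr => l _ do rewrite ec mulr_sumr.
  rewrite exchange_big big1 // => j _; under eq_bigr => l _ do rewrite mulrA.
  rewrite -mulr_suml; have /rowP/(_ (enum_rank j)) := uC0; rewrite !mxE => E.
  rewrite (reindex_onto enum_val enum_rank) /= => [|l _]; last by rewrite enum_rankK.
  rewrite (eq_bigl xpredT) => [|l]; last by rewrite enum_valK eqxx.
  transitivity (0 * v j x); last by rewrite mul0r.
  congr (_ * _); rewrite -[RHS]E; apply: eq_bigr => l _.
  by rewrite !mxE /u' enum_valK enum_rankK.
have Cunit : C \in unitmx by rewrite -row_free_unit.
pose w := (\row_j b (enum_val j)) *m invmx C.
exists (fun i => w 0 (enum_rank i)) => x; rewrite fb.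
under [RHS]eq_bigr => i _ do rewrite ec mulr_sumr.
rewrite exchange_big; apply: eq_bigr => j _ /=.
under eq_bigr => i _ do rewrite mulrA.
rewrite -mulr_suml; congr (_ * _).
have /rowP/(_ (enum_rank j)) : w *m C = \row_j b (enum_val j) by rewrite mulmxKV.
rewrite !mxE enum_rankK => <-.
rewrite [RHS](reindex_onto enum_val enum_rank) /= => [|l _]; last by rewrite enum_rankK.
rewrite [RHS](eq_bigl xpredT) => [|l]; last by rewrite enum_valK eqxx.
by apply: eq_bigr => l _; rewrite enum_valK [C _ _]mxE enum_rankK.
Qed.

End Exchange.

Section PolyFun.
Variables (R : realType) (d N : nat).
Notation S := (simplex d.+1 N).
Implicit Types (h g : S -> R).

Let pt (x : S) : 'I_d -> R := fun i => (x (emb i))%:R.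

(** Counterpart of [polyfun] for plain functions, which lets closure properties be stated
    pointwise. *)
Definition pfun (k : nat) h : Prop :=
  exists2 p : {mpoly R[d]}, (msize p <= k)%N & forall x : S, h x = p.@[pt x].

Lemma pfun_polyfun k (f : {ffun S -> R}) : pfun k f -> polyfun k f.
Proof. by []. Qed.

Lemma pfun_ext k h g : h =1 g -> pfun k h -> pfun k g.
Proof. by move=> E [p sp hp]; exists p => // x; rewrite -E. Qed.

Lemma pfun_leq k l h : (k <= l)%N -> pfun k h -> pfun l h.
Proof. by move=> le_kl [p sp hp]; exists p => //; apply: leq_trans le_kl. Qed.

Lemma pfun0 k : pfun k (fun=> 0).
Proof. by exists 0 => [|x]; rewrite ?msize0 ?meval0. Qed.

Lemma pfunC k c : pfun k.+1 (fun=> c).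
Proof.
exists c%:MP => [|x]; last by rewrite mevalC.
by rewrite msizeC; case: (c != 0).
Qed.

Lemma pfunD k h g : pfun k h -> pfun k g -> pfun k (fun x => h x + g x).
Proof.
move=> [p sp hp] [q sq gq]; exists (p + q) => [|x]; last by rewrite mevalD hp gq.
by rewrite (leq_trans (msizeD_le _ _)) // geq_max sp.
Qed.

Lemma pfunZ k c h : pfun k h -> pfun k (fun x => c * h x).
Proof.
move=> [p sp hp]; exists (c *: p) => [|x]; last by rewrite mevalZ hp.
exact: leq_trans (msizeZ_le _ _) sp.
Qed.

Lemma pfunB k h g : pfun k h -> pfun k g -> pfun k (fun x => h x - g x).
Proof.
by move=> hk /(pfunZ (-1)) gk; apply: pfun_ext (pfunD hk gk) => x; rewrite mulN1r.
Qed.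

Lemma pfun_sum k (I : Type) (r : seq I) (P : pred I) (F : I -> S -> R) :
  (forall i, P i -> pfun k (F i)) -> pfun k (fun x => \sum_(i <- r | P i) F i x).
Proof.
move=> FP; elim: r => [|i r IH].
  by apply: pfun_ext (pfun0 _) => x; rewrite big_nil.
have [Pi|nPi] := boolP (P i).
  by apply: pfun_ext (pfunD (FP i Pi) IH) => x; rewrite big_cons Pi.
by apply: pfun_ext IH => x; rewrite big_cons (negbTE nPi).
Qed.

Lemma pfunM k l h g : pfun k.+1 h -> pfun l.+1 g -> pfun (k + l).+1 (fun x => h x * g x).
Proof.
move=> [p sp hp] [q sq gq]; exists (p * q) => [|x]; last by rewrite mevalM hp gq.
have [->|p0] := eqVneq p 0; first by rewrite mul0r msize0.
have [->|q0] := eqVneq q 0; first by rewrite mulr0 msize0.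
rewrite msizeM // -subn1 leq_subLR add1n -addnS -addSn; exact: leq_add.
Qed.

Lemma pfun_prod (I : Type) (r : seq I) (e : I -> nat) (F : I -> S -> R) :
  (forall i, pfun (e i).+1 (F i)) ->
  pfun (\sum_(i <- r) e i)%N.+1 (fun x => \prod_(i <- r) F i x).
Proof.
move=> FP; elim: r => [|i r IH].
  by rewrite big_nil; apply: pfun_ext (pfunC 0 1) => x; rewrite big_nil.
by rewrite big_cons; apply: pfun_ext (pfunM (FP i) IH) => x; rewrite big_cons.
Qed.

Lemma pfun_poch h m : pfun 2 h -> pfun m.+1 (fun x => poch (h x) m).
Proof.
move=> h2; elim: m => [|m IH]; first by apply: pfun_ext (pfunC 0 1) => x; rewrite poch0.
rewrite -[m.+1]addn1.
by apply: pfun_ext (pfunM IH (pfunD h2 (pfunC 1 m%:R))) => x; rewrite addn1 pochSr.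
Qed.

Lemma pfun_emb (i : 'I_d) : pfun 2 (fun x : S => (x (emb i))%:R).
Proof. by exists 'X_i => [|x]; rewrite ?msizeX ?mdeg1 ?mevalXU. Qed.

Lemma pfun_coord (i : 'I_d.+1) : pfun 2 (fun x : S => (x i)%:R).
Proof.
have [lt_id|le_di] := ltnP i d.
  apply: pfun_ext (pfun_emb (Ordinal lt_id)) => x.
  by congr (_%:R); congr (fun_of_multinom _ _); apply/val_inj.
(* The last coordinate is N minus the others, hence also of degree at most 1. *)
have -> : i = ord_max by apply/val_inj/eqP; rewrite eqn_leq le_di -ltnS ltn_ord.
apply: pfun_ext (pfunB (pfunC 1 N%:R) (pfun_sum (index_enum 'I_d) (P := xpredT) (fun j _ => pfun_emb j))) => x.
have -> : N%:R = (mdeg x)%:R :> R by rewrite mdeg_simplex.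
by rewrite mdegE big_ord_recr /= natrD natr_sum addrAC subrr add0r.
Qed.

Lemma pfun_fall alpha : pfun (mdeg alpha).+1 (fun x : S => fall R alpha x).
Proof.
rewrite mdegE; apply: pfun_prod => i; apply: pfun_poch.
by apply: pfun_ext (pfunZ (-1) (pfun_coord i)) => x; rewrite mulN1r.
Qed.

Lemma pfun_fhom p f : fhom 0 p f -> pfun p.+1 (fun x : S => f x).
Proof.
elim=> [alpha <- _||f1 f2 _ IH1 _ IH2|c f1 _ IH|f1 f2 E _ IH].
- exact: pfun_fall.
- exact: pfun0.
- exact: pfunD.
- exact: pfunZ.
- by apply: pfun_ext IH => x; exact: E.
Qed.

(** The monomials carry the same index type as the H_nu with |nu| < k; this is the dimension count
    for [free_span_exchange]. *)
Lemma pfun_monomials k h : pfun k h -> exists c : 'X_{1..d < k} -> R,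
  forall x, h x = \sum_m c m * ('X_[m] : {mpoly R[d]}).@[pt x].
Proof.
move=> [p sp hp]; exists (fun m => p@_m) => x.
rewrite hp {1}(mpolywE sp) raddf_sum /=; apply: eq_bigr => m _.
by rewrite mevalZ.
Qed.

End PolyFun.

(** * The orthogonal Hahn basis and the monic Hahn polynomials *)

Section Inner.
Variables (R : realType) (d : nat) (kappa : 'I_d.+1 -> R).
Hypothesis kappa_gt : forall i, -1 < kappa i.
Variable N : nat.
Notation S := (simplex d.+1 N).
Implicit Types f g h : S -> R.
Notation ip := (@hahn_inner R d kappa N).

Definition hahn_mass : R := N`!%:R / poch (\sum_i kappa i + d%:R + 1) N.

Lemma hahn_mass_gt0 : 0 < hahn_mass.
Proof.
by apply: divr_gt0; [rewrite ltr0n fact_gt0|apply/poch_gt0/(sum_kappa_gt kappa_gt)].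
Qed.

Lemma ipE f g : ip f g = hahn_mass * \sum_(x : S) hahn_w kappa x * (f x * g x).
Proof. by congr (_ * _); apply: eq_bigr => x _; rewrite mulrC. Qed.

Lemma eq_ipl f f' g : f =1 f' -> ip f g = ip f' g.
Proof. by move=> E; rewrite !ipE; congr (_ * _); apply: eq_bigr => x _; rewrite E. Qed.

Lemma ipC f g : ip f g = ip g f.
Proof. by rewrite !ipE; congr (_ * _); apply: eq_bigr => x _; rewrite [f x * _]mulrC. Qed.

Lemma ip_sum (I : Type) (r : seq I) (P : pred I) (c : I -> R) (F : I -> S -> R) g :
  ip (fun x => \sum_(i <- r | P i) c i * F i x) g = \sum_(i <- r | P i) c i * ip (F i) g.
Proof.
under [RHS]eq_bigr => i _ do rewrite ipE mulrCA mulr_sumr.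
rewrite ipE -mulr_sumr; congr (_ * _); rewrite exchange_big; apply: eq_bigr => x _ /=.
by rewrite mulr_suml mulr_sumr; apply: eq_bigr => i _; ring.
Qed.

Lemma ipB f f' g : ip (fun x => f x - f' x) g = ip f g - ip f' g.
Proof.
rewrite !ipE -mulrBr -sumrB; congr (_ * _); apply: eq_bigr => x _; ring.
Qed.

Lemma ip_definite f : ip f f = 0 -> f =1 fun=> 0.
Proof.
move=> /eqP; rewrite ipE mulf_eq0 gt_eqF ?hahn_mass_gt0 //= => /eqP E x.
have pos (y : S) : true -> 0 <= hahn_w kappa y * (f y * f y).
  by move=> _; apply: mulr_ge0; [exact/ltW/hahn_w_gt0|rewrite -expr2 sqr_ge0].
have /eqP := psumr_eq0P pos E (i := x) isT.
by rewrite mulf_eq0 gt_eqF ?hahn_w_gt0 //= mulf_eq0 orbb => /eqP.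
Qed.

Notation H := (fun nu => fun x : S => hahn kappa N nu x).

Lemma ip_hahn nu mu : nu != mu -> ip (H nu) (H mu) = 0.
Proof.
move=> ne; have [C _ HC] := sum_hahn_core kappa_gt nu.
rewrite ipE; under eq_bigr => x _ do rewrite !hahnE.
transitivity (hahn_mass * (hahn_scale kappa N nu * hahn_scale kappa N mu * \sum_(x : S) hahn_w kappa x *
   (hahn_core kappa N nu x * hahn_core kappa N mu x))).
  by congr (_ * _); rewrite mulr_sumr; apply: eq_bigr => x _; ring.
by rewrite HC (negbTE ne) !mulr0.
Qed.

Lemma hahn_norm_gt0 nu : (mdeg nu <= N)%N -> 0 < hahn_norm kappa N nu.
Proof.
move=> le_nuN; have [C C_gt0 HC] := sum_hahn_core kappa_gt nu.
rewrite /hahn_norm ipE; under eq_bigr => x _ do rewrite !hahnE.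
have c_neq0 := hahn_scale_neq0 kappa_gt le_nuN; set c := hahn_scale _ _ _ in c_neq0 *.
rewrite (_ : \sum_(x : S) _ = c ^+ 2 * \sum_(x : S) hahn_w kappa x *
   (hahn_core kappa N nu x * hahn_core kappa N nu x)); last first.
  by rewrite mulr_sumr; apply: eq_bigr => x _; ring.
rewrite HC eqxx le_nuN mulr_gt0 ?hahn_mass_gt0 // mulr_gt0 //.
  by rewrite lt_def sqrf_eq0 c_neq0 sqr_ge0.
apply: divr_gt0; last by rewrite ltr0n fact_gt0.
apply: mulr_gt0 => //; apply: poch_gt0; rewrite ltr_wpDr //.
rewrite big_split /= sumr_const card_ord -natr1 addrA.
exact: sum_kappa_gt.
Qed.

Lemma pfun_hahn nu : pfun (mdeg nu).+1 (H nu).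
Proof.
apply: pfun_ext (pfunZ _ (pfun_fhom N (fhom_hahn_core kappa nu))) => x.
by rewrite hahnE mdeg_simplex.
Qed.

(** The H_mu are independent, being orthogonal with positive norms (k <= N + 1 gives |mu| <= N), and
    lie in the span of equally many monomials; so they span as much. Pairing with H_mu gives the
    coefficients. *)
Lemma pfun_expand k h : (k <= N.+1)%N -> pfun k h -> forall x,
  h x = \sum_(mu : 'X_{1..d < k}) ip h (H mu) / hahn_norm kappa N mu * H mu x.
Proof.
move=> le_kN hk.
have norm_gt0 (mu : 'X_{1..d < k}) : 0 < hahn_norm kappa N mu.
  by apply: hahn_norm_gt0; rewrite -ltnS (leq_trans (bmdeg mu)).
have coefE c (mu : 'X_{1..d < k}) :
    ip (fun x => \sum_(i : 'X_{1..d < k}) c i * H i x) (H mu) = c mu * hahn_norm kappa N mu.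
  rewrite ip_sum (bigD1 mu) //= big1 ?addr0 // => i ne.
  by rewrite ip_hahn ?mulr0.
have [|c|c hc] := @free_span_exchange R 'X_{1..d < k} S
  (fun m x => ('X_[m] : {mpoly R[d]}).@[fun i : 'I_d => (x (emb i))%:R])
  (fun mu => H mu) h _ _ (pfun_monomials hk).
- by move=> mu; apply: pfun_monomials; apply: pfun_leq (pfun_hahn mu); exact: bmdeg.
- move=> c0 mu; have := coefE c mu; rewrite (eq_ipl _ c0) ipE big1 ?mulr0 => [E|x _]; last first.
    by rewrite mul0r mulr0.
  by apply/eqP; have /eqP := esym E; rewrite mulf_eq0 [X in _ || X]gt_eqF ?orbF.
move=> x; rewrite hc; apply: eq_bigr => mu _.
by rewrite (eq_ipl _ hc) coefE mulfK ?gt_eqF.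
Qed.

Lemma ip_hahn_lower nu k h : (k <= mdeg nu)%N -> (mdeg nu <= N)%N -> pfun k h ->
  ip (H nu) h = 0.
Proof.
move=> le_k le_nu hk; rewrite ipC (eq_ipl _ (pfun_expand _ hk)); last first.
  by rewrite (leq_trans le_k) // ltnW.
rewrite ip_sum big1 // => mu _; rewrite ip_hahn ?mulr0 //.
by apply: contraTneq (bmdeg mu) => ->; rewrite -leqNgt.
Qed.

Definition lower_orth (n : nat) f : Prop := forall g, pfun n g -> ip f g = 0.

(** The uniqueness principle by which images under [monic_lift] are identified. *)
Lemma lower_orth_eq0 n f : pfun n f -> lower_orth n f -> f =1 fun=> 0.
Proof. by move=> fn orth; apply: ip_definite; exact: orth. Qed.

Lemma lower_orthB n f g : lower_orth n f -> lower_orth n g ->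
  lower_orth n (fun x => f x - g x).
Proof. by move=> fo go h hn; rewrite ipB fo // go // subr0. Qed.

Lemma monic_hahn_spec alpha : (mdeg alpha <= N)%N ->
  is_monic_hahn kappa alpha (monic_hahn kappa N alpha).
Proof.
set n := mdeg alpha => le_nN; apply: xgetPex.
have mn : pfun n.+1 (hahn_m R N alpha).
  by apply: pfun_ext (pfunZ ((-1) ^+ n) (pfun_fall R N alpha)) => x; rewrite ffunE.
(* The orthogonal projection of m_alpha onto degree below n; subtracting it proves the existence
   that [xget] calls for. *)
pose proj (x : S) := \sum_(mu : 'X_{1..d < n})
  ip (hahn_m R N alpha) (H mu) / hahn_norm kappa N mu * H mu x.
have projn : pfun n proj.
  apply: pfun_sum => mu _; apply: pfunZ; apply: pfun_leq (pfun_hahn mu).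
  exact: bmdeg.
exists [ffun x => hahn_m R N alpha x - proj x]; split; last first.
  apply: pfun_polyfun; apply: pfun_ext (pfunZ (-1) projn) => x.
  by rewrite !ffunE; ring.
split.
  apply: pfun_polyfun; apply: pfun_ext (pfunB mn (pfun_leq (leqnSn n) projn)) => x.
  by rewrite !ffunE.
move=> g gn; rewrite (eq_ipl _ (ffunE _)) ipB.
have le_n : (n <= N.+1)%N by exact: leqW.
(* Expanding g reduces the claim to g = H_mu, where m_alpha and its projection have the same inner
   product. *)
rewrite ![ip _ g]ipC (eq_ipl _ (pfun_expand le_n gn)) (eq_ipl proj (pfun_expand le_n gn)).
rewrite !ip_sum -sumrB big1 // => mu _; rewrite -mulrBr; apply/eqP.
rewrite mulf_eq0 subr_eq0; apply/orP; right; apply/eqP; rewrite ![ip (H mu) _]ipC.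
have norm_gt0 : 0 < hahn_norm kappa N mu.
  by apply: hahn_norm_gt0; rewrite (leq_trans _ le_nN) // ltnW // bmdeg.
rewrite ip_sum (bigD1 mu) //= big1 ?addr0 => [|i ne]; last by rewrite ip_hahn ?mulr0.
by rewrite mulfVK ?gt_eqF.
Qed.

(* The operator T of the introduction. *)
Definition monic_lift n (f : 'X_{1..d.+1} -> R) (x : S) : R :=
  \sum_(beta : simplex d.+1 n) f beta / (mnm_fact beta)%:R * monic_hahn kappa N beta x.

Lemma monic_lift_orth n (f : 'X_{1..d.+1} -> R) : (n <= N)%N -> lower_orth n (monic_lift n f).
Proof.
move=> le_nN g gn; rewrite ip_sum big1 // => beta _.
have [[_ orth] _] := @monic_hahn_spec beta (etrans (congr1 (fun m => m <= N)%N (mdeg_simplex beta)) le_nN).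
pose g' := [ffun x => g x].
have g'n : polyfun (mdeg beta) g'.
  by rewrite mdeg_simplex; apply: pfun_polyfun; apply: pfun_ext gn => x; rewrite ffunE.
have := orth g' g'n; rewrite ![ip _ g']ipC (eq_ipl _ (ffunE _)) ipC => ->.
by rewrite mulr0.
Qed.

(** By [fhom_expand], f is the same combination of the m_beta, and each Q_beta - m_beta has degree
    below n. *)
Lemma monic_lift_fhom n (f : 'X_{1..d.+1} -> R) : (n <= N)%N -> fhom 0 n f ->
  pfun n (fun x => f x - monic_lift n f x).
Proof.
move=> le_nN fn.
have : pfun n (fun x => \sum_(beta : simplex d.+1 n) f beta / (mnm_fact beta)%:R *
    (-1 * (monic_hahn kappa N beta x - hahn_m R N beta x))).
  apply: pfun_sum => beta _; apply: pfunZ; apply: pfunZ.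
  have degb := mdeg_simplex beta; have le_bN : (mdeg beta <= N)%N by rewrite degb.
  have [_ Qm] := monic_hahn_spec le_bN; rewrite degb in Qm.
  by apply: pfun_ext (Qm : pfun n _) => x; rewrite !ffunE.
apply: pfun_ext => x; rewrite (fhom_expand x fn) /monic_lift -sumrB.
by apply: eq_bigr => beta _; rewrite [hahn_m _ _ _ _]ffunE mdeg_simplex -/(fall R beta x); ring.
Qed.

End Inner.

(** * The two expansions *)

Section Identities.
Variables (R : realType) (d n N : nat) (kappa : 'I_d.+1 -> R).
Hypothesis kappa_gt : forall i, -1 < kappa i.
Hypothesis le_nN : (n <= N)%N.
Notation lift f x := (monic_lift kappa (N := N) n f x).

Lemma lower_orth_hahn (nu : 'X_{1..d}) : mdeg nu = n ->
  lower_orth kappa n (fun x : simplex d.+1 N => hahn kappa N nu x).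
Proof. by move=> degn g gn; apply: (ip_hahn_lower kappa_gt (k := n)); rewrite ?degn. Qed.

(** After scaling, both sides are orthogonal to lower degrees and their difference has lower degree,
    so [lower_orth_eq0] applies; the nonzero scale is then cancelled. *)
Lemma lift_hahn_core (nu : 'X_{1..d}) (x : simplex d.+1 N) : mdeg nu = n ->
  lift (fun y => hahn_core kappa (mdeg y) nu y) x = hahn_core kappa N nu x.
Proof.
move=> degn; have hom := fhom_hahn_core kappa nu; rewrite degn in hom.
have low := monic_lift_fhom kappa_gt le_nN hom.
have le_nuN : (mdeg nu <= N)%N by rewrite degn.
have scale0 := hahn_scale_neq0 kappa_gt le_nuN.
have orth := @lower_orthB _ _ kappa N n _ _ (lower_orth_hahn degn)
  (monic_lift_orth kappa_gt (fun y => hahn_scale kappa N nu * hahn_core kappa (mdeg y) nu y) le_nN).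
have E y : monic_lift kappa n (fun y => hahn_scale kappa N nu * hahn_core kappa (mdeg y) nu y) y
    = hahn_scale kappa N nu * lift (fun y => hahn_core kappa (mdeg y) nu y) y.
  by rewrite /monic_lift mulr_sumr; apply: eq_bigr => b _; rewrite !mulrA.
have := lower_orth_eq0 kappa_gt (pfun_ext _ (pfunZ (hahn_scale kappa N nu) low)) orth.
move=> /(_ _ x)/eqP; rewrite E hahnE -mulrBr mulf_eq0 (negbTE scale0) /= subr_eq0.
move=> H; apply/esym/eqP/H => y.
by rewrite E hahnE mdeg_simplex mulrBr.
Qed.

Lemma lift_hahn (nu : 'X_{1..d}) (x : simplex d.+1 N) : mdeg nu = n ->
  lift (fun y => hahn kappa n nu y) x =
  poch (- N%:R) n / ((-1) ^+ n * n`!%:R) * hahn kappa N nu x.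
Proof.
move=> degn.
transitivity (hahn_scale kappa n nu * lift (fun y => hahn_core kappa (mdeg y) nu y) x).
  rewrite /monic_lift mulr_sumr; apply: eq_bigr => b _.
  by rewrite hahnE mdeg_simplex !mulrA.
(* The scales for n and N differ only by (-n)_n against (-N)_n, and (-n)_n = (-1)^n n!. *)
rewrite lift_hahn_core // hahnE /hahn_scale degn !poch_natN_fact // subnn fact0 divr1.
have := factr_neq0 R n; have := factr_neq0 R N; have := factr_neq0 R (N - n) => ? ? ?.
have ? : (-1) ^+ n != 0 :> R by rewrite signr_eq0.
by field; apply/and4P.
Qed.

(* For |nu| < n, multiplying by the nonzero constant (-n+|nu|)_{n-|nu|} turns
   H_nu(.;kappa,n) into the restriction of a homogeneous function of degree n. *)
Lemma lift_hahn_lower (nu : 'X_{1..d}) (x : simplex d.+1 N) : (mdeg nu < n)%N ->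
  lift (fun y => hahn kappa n nu y) x = 0.
Proof.
move=> lt_nun; set p := mdeg nu in lt_nun.
have hom := fhom_mul_poch (n - p) (fhom_hahn_core kappa nu).
rewrite -/p subnKC ?(ltnW lt_nun) // in hom; set f := (fun x => _) in hom.
have fE y : f y = hahn_core kappa (mdeg y) nu y * poch (- (mdeg y)%:R + p%:R) (n - p).
  by rewrite [X in poch (- X%:R + _) _]mdegE.
have low := monic_lift_fhom kappa_gt le_nN hom.
have fn : pfun n (fun x : simplex d.+1 N => f x).
  apply: (pfun_leq lt_nun).
  apply: pfun_ext (pfunZ (poch (- N%:R + p%:R) (n - p)) (pfun_fhom N (fhom_hahn_core kappa nu))) => y.
  by rewrite fE mdeg_simplex mulrC.
(* On Z_N the extra factor of f is constant, so f has degree below n, and so has its lift, which is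
   orthogonal to such degrees. *)
have lift0 : monic_lift kappa (N := N) n f =1 fun=> 0.
  apply: (lower_orth_eq0 kappa_gt _ (monic_lift_orth kappa_gt f le_nN)).
  by apply: pfun_ext (pfunB fn low) => y; rewrite subKr.
have c0 : poch (- n%:R + p%:R) (n - p) != 0 :> R.
  have -> : - n%:R + p%:R = - (n - p)%:R :> R by rewrite natrB ?(ltnW lt_nun) //; ring.
  by rewrite poch_natN ffactnn mulf_neq0 ?signr_eq0 ?factr_neq0.
apply: (mulfI c0); rewrite mulr0.
transitivity (hahn_scale kappa n nu * lift f x); last by rewrite lift0 mulr0.
rewrite /monic_lift !mulr_sumr; apply: eq_bigr => b _.
rewrite fE mdeg_simplex hahnE; ring.
Qed.

(** On Z_n the delta at alpha is a multiple of m_alpha, hence of degree at most n; its inner product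
    with H_mu is the weight at alpha times H_mu(alpha). *)
Lemma delta_expand (alpha beta : simplex d.+1 n) :
  (beta == alpha)%:R = \sum_(mu : 'X_{1..d < n.+1})
    hahn_mass kappa n * hahn_w kappa alpha * hahn kappa n mu alpha
      / hahn_norm kappa n mu * hahn kappa n mu beta :> R.
Proof.
pose h (b : simplex d.+1 n) : R := (b == alpha)%:R.
have hn : pfun n.+1 h.
  have := pfunZ (fall R alpha alpha)^-1 (pfun_fall R n alpha).
  rewrite mdeg_simplex; apply: pfun_ext => b; rewrite /h.
  have [->|ne] := eqVneq b alpha.
    by rewrite mulVf // fall_diag mulf_neq0 ?signr_eq0 ?mnm_fact_neq0.
  rewrite (@fall_eq0 _ _ alpha b) ?mulr0 ?mdeg_simplex //.
  by apply: contraNneq ne => E; apply/eqP/val_inj/val_inj; rewrite /= E.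
rewrite -/(h beta) (pfun_expand kappa_gt (leqnn _) hn); apply: eq_bigr => mu _.
congr (_ / _ * _); rewrite ipE (bigD1 alpha) //= big1 => [|b ne]; last first.
  by rewrite /h (negbTE ne) mul0r mulr0.
by rewrite /h eqxx addr0 mul1r mulrA.
Qed.

Lemma big_simplex_bmultinom (F : 'X_{1..d} -> R) :
  \sum_(mu : 'X_{1..d < n.+1} | mdeg mu == n) F mu = \sum_(nu : simplex d n) F nu.
Proof.
rewrite (reindex_omap (fun nu : simplex d n => \val nu) insub) /=.
  apply: eq_bigl => nu; rewrite mdeg_simplex eqxx /=.
  by apply/eqP; exact: valK.
by move=> mu degmu; rewrite insubT.
Qed.

Lemma hahn_monic_hahn (x : simplex d.+1 N) (nu : simplex d n) :
  hahn kappa N nu x =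
  (-1) ^+ n * n`!%:R / poch (- N%:R) n *
  \sum_(alpha : simplex d.+1 n)
    hahn kappa n nu alpha / (mnm_fact alpha)%:R * monic_hahn kappa N alpha x.
Proof.
have := lift_hahn x (mdeg_simplex nu); rewrite /monic_lift => ->.
rewrite poch_natN_fact //.
have := factr_neq0 R n; have := factr_neq0 R N; have := factr_neq0 R (N - n) => ? ? ?.
have ? : (-1) ^+ n != 0 :> R by rewrite signr_eq0.
by field; apply/and4P.
Qed.

Lemma monic_hahn_hahn (x : simplex d.+1 N) (alpha : simplex d.+1 n) :
  monic_hahn kappa N alpha x =
  mpoch (fun i : 'I_d.+1 => kappa i + 1) alpha * poch (- N%:R) n
  / ((-1) ^+ n * poch (\sum_(i < d.+1) kappa i + d%:R + 1) n) *
  \sum_(nu : simplex d n)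
    hahn kappa n nu alpha / hahn_norm kappa n nu * hahn kappa N nu x.
Proof.
have a0 := mnm_fact_neq0 R alpha.
(* Q_alpha is alpha! times the lift of the delta at alpha. *)
transitivity ((mnm_fact alpha)%:R * \sum_(beta : simplex d.+1 n)
    (beta == alpha)%:R / (mnm_fact beta)%:R * monic_hahn kappa N beta x).
  rewrite (bigD1 alpha) //= big1 => [|b ne]; last by rewrite (negbTE ne) !mul0r.
  by rewrite eqxx addr0 mul1r mulrA mulfV ?mul1r.
transitivity ((mnm_fact alpha)%:R * \sum_(mu : 'X_{1..d < n.+1})
    hahn_mass kappa n * hahn_w kappa alpha * (hahn kappa n mu alpha / hahn_norm kappa n mu)
      * lift (fun y => hahn kappa n mu y) x).
  congr (_ * _); under eq_bigr => b _ do rewrite delta_expand !mulr_suml.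
  rewrite exchange_big; apply: eq_bigr => mu _ /=.
  rewrite /monic_lift mulr_sumr; apply: eq_bigr => b _; ring.
(* The lift annihilates the H_mu with |mu| < n, leaving the sum over |mu| = n. *)
rewrite (bigID (fun mu : 'X_{1..d < n.+1} => mdeg mu == n)) /=.
rewrite [X in _ + X]big1 ?addr0 => [|mu ne]; last first.
  by rewrite lift_hahn_lower ?mulr0 // ltn_neqAle ne -ltnS bmdeg.
rewrite -(big_simplex_bmultinom (fun nu : 'X_{1..d} =>
  hahn kappa n nu alpha / hahn_norm kappa n nu * hahn kappa N nu x)) !mulr_sumr; apply: eq_bigr => mu /eqP degmu.
(* The alpha! cancels against the weight, and the n! of the mass against that of [lift_hahn]. *)
rewrite lift_hahn // /hahn_mass /hahn_w.
have := poch_neq0 n (sum_kappa_gt kappa_gt); have := factr_neq0 R n => ? ?.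
have ? : (-1) ^+ n != 0 :> R by rewrite signr_eq0.
have ? : hahn_norm kappa n mu != 0 by rewrite gt_eqF ?hahn_norm_gt0 ?degmu.
by field; rewrite ?a0; apply/and5P.
Qed.

End Identities.

Theorem proposition3p3 (R : realType) (d n N : nat) (kappa : 'I_d.+1 -> R)
    (hd : (1 <= d)%N) (hnN : (n <= N)%N)
    (hkappa : forall i : 'I_d.+1, -1 < kappa i) :
  (forall (x : simplex d.+1 N) (nu : simplex d n),
     hahn kappa N nu x =
       (-1) ^+ n * n`!%:R / poch (- N%:R) n *
       \sum_(alpha : simplex d.+1 n)
         hahn kappa n nu alpha / (mnm_fact alpha)%:R
         * monic_hahn kappa N alpha x)
  /\
  (forall (x : simplex d.+1 N) (alpha : simplex d.+1 n),
     monic_hahn kappa N alpha x =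
       mpoch (fun i : 'I_d.+1 => kappa i + 1) alpha * poch (- N%:R) n
       / ((-1) ^+ n * poch (\sum_(i < d.+1) kappa i + d%:R + 1) n) *
       \sum_(nu : simplex d n)
         hahn kappa n nu alpha / hahn_norm kappa n nu * hahn kappa N nu x).
Proof.
by split=> [x nu|x alpha]; [exact: hahn_monic_hahn|exact: monic_hahn_hahn].
Qed.
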